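(* Let $\rho$ be a $C^2$ function on a domain $\Omega\subset\mathbb{S}^2$, let $p\in\Omega$, and let $(x,y)$ be the coordinates around $p$ provided by stereographic projection from the antipodal point of $p$, with $p$ corresponding to $(0,0)$ and the round metric equal to $\frac{16|dz|^2}{(4+|z|^2)^2}$, $z=x+iy$. At $p$ the metric $g_{ij}$ induced on $\Sigma(\rho)$ from $\mathbb{H}^3$ (the pullback by $R_\rho$ of the hyperbolic metric, expressed in the frame $\partial_x,\partial_y$) is $$g_{ij}(p)=\begin{pmatrix}\dfrac{e^\rho}{2}+\Big(\rho_{xx}+\dfrac{\rho_y^2-\rho_x^2-1}{2}\Big)e^{-\rho}&(\rho_{xy}-\rho_x\rho_y)e^{-\rho}\\[2mm](\rho_{xy}-\rho_x\rho_y)e^{-\rho}&\dfrac{e^\rho}{2}+\Big(\rho_{yy}+\dfrac{\rho_x^2-\rho_y^2-1}{2}\Big)e^{-\rho}\end{pmatrix}^2,$$ with all quantities evaluated at $p$ (the exponent denotes the matrix square).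
   Context: Hyperbolic 3-space $\mathbb{H}^3$ is the open unit ball in $\mathbb{R}^3$ with metric $4|dx|^2/(1-|x|^2)^2$, with ideal boundary the unit sphere $\mathbb{S}^2$. For $\rho$ on $\Omega\subset\mathbb{S}^2$, $\Sigma(\rho)$ is the surface (outer envelope of the horospheres based at $\theta$ with signed distance $\rho(\theta)$ from the origin) parametrized by $R_\rho:\Omega\to\mathbb{H}^3$, $$R_\rho(\theta)=\frac{|D\rho|^2+(e^{2\rho}-1)}{|D\rho|^2+(e^{\rho}+1)^2}\,\theta+\frac{2D\rho}{|D\rho|^2+(e^\rho+1)^2},$$ where $D\rho$ is the gradient of $\rho$ in the round metric, regarded as a vector in $\mathbb{R}^3$ tangent to $\mathbb{S}^2$ at $\theta$. Subscripts $x,y$ denote partial derivatives. *)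

(* Defs.v *)
From HB Require Import structures.
From mathcomp Require Import all_boot all_order all_algebra.
From mathcomp Require Import ring lra.
From mathcomp Require Import all_classical all_reals all_analysis.

Set Implicit Arguments.
Unset Strict Implicit.
Unset Printing Implicit Defensive.

Import Order.TTheory GRing.Theory Num.Theory.
Import numFieldNormedType.Exports.

Local Open Scope classical_set_scope.
Local Open Scope ring_scope.

(* The Euclidean inner product is introduced by hand because the norm `|_| of
   'rV[R]_n is the sup norm; only the (same) topology of 'rV[R]_n is used. *)
Definition dot (R : realType) (n : nat) (u v : 'rV[R]_n) : R :=
  \sum_(i < n) u 0 i * v 0 i.

Definition sphere2 (R : realType) : set 'rV[R]_3 := [set t | dot t t = 1].

Definition sphere_domain (R : realType) (Omega : set 'rV[R]_3) : Prop :=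
  (exists2 U : set 'rV[R]_3, open U & Omega = @sphere2 R `&` U)
  /\ connected Omega /\ Omega !=set0.

(* (e1, e2) is an orthonormal basis of the tangent plane of the sphere at p. *)
Definition tangent_frame (R : realType) (p e1 e2 : 'rV[R]_3) : Prop :=
  [/\ dot e1 e1 = 1, dot e2 e2 = 1, dot e1 e2 = 0, dot p e1 = 0 & dot p e2 = 0].

(* Stereographic projection from - p onto the affine tangent plane at p: the
   line through - p and t meets that plane at p + x e1 + y e2, and the
   coordinates of t are z = (x, y). *)
Definition stereo (R : realType) (p e1 e2 t : 'rV[R]_3) : 'rV[R]_2 :=
  \row_(i < 2) (2 * dot (if i == 0 then e1 else e2) t / (1 + dot p t)).

(* The inverse parametrization of the sphere minus - p. It maps 0 to p, and
   it pulls the round metric back to 16 |dz|^2 / (4 + |z|^2)^2. *)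
Definition stereo_inv (R : realType) (p e1 e2 : 'rV[R]_3) (z : 'rV[R]_2) :
    'rV[R]_3 :=
  (4 + dot z z)^-1 *:
    ((4 - dot z z) *: p + 4 *: (z 0 0 *: e1 + z 0 1 *: e2)).

Section DotTheory.
Variables (R : realType) (n : nat).
Implicit Types (u v w : 'rV[R]_n) (a : R).

Lemma dotC u v : dot u v = dot v u.
Proof. by apply: eq_bigr => i _; rewrite mulrC. Qed.

Lemma dotDr u v w : dot u (v + w) = dot u v + dot u w.
Proof. by rewrite -big_split; apply: eq_bigr => i _; rewrite mxE mulrDr. Qed.

Lemma dotZr a u v : dot u (a *: v) = a * dot u v.
Proof. by rewrite mulr_sumr; apply: eq_bigr => i _; rewrite mxE mulrCA. Qed.

Lemma dot_ge0 u : 0 <= dot u u.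
Proof. by apply: sumr_ge0 => i _; rewrite -expr2 sqr_ge0. Qed.

End DotTheory.

Section StereoTheory.
Variables (R : realType) (p e1 e2 : 'rV[R]_3).
Hypotheses (pS : sphere2 p) (pe : tangent_frame p e1 e2).

Let dot2 (z : 'rV[R]_2) : dot z z = z 0 0 ^+ 2 + z 0 1 ^+ 2.
Proof.
rewrite /dot !big_ord_recl big_ord0 addr0 !expr2.
by rewrite (_ : lift ord0 ord0 = 1) //; exact: val_inj.
Qed.

Let den_neq0 (z : 'rV[R]_2) : 4 + dot z z != 0.
Proof. by rewrite gt_eqF // ltr_pwDl ?dot_ge0 // ltr0n. Qed.

Lemma dot_stereo_inv (u : 'rV[R]_3) (z : 'rV[R]_2) :
  dot u (stereo_inv p e1 e2 z) = (4 + dot z z)^-1 *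
    ((4 - dot z z) * dot u p + 4 * (z 0 0 * dot u e1 + z 0 1 * dot u e2)).
Proof. by rewrite dotZr dotDr !dotZr dotDr !dotZr. Qed.

Lemma stereo_inv_sphere2 (z : 'rV[R]_2) : sphere2 (stereo_inv p e1 e2 z).
Proof.
have [h11 h22 h12 h1 h2] := pe; have hz := den_neq0 z.
have hp : dot p p = 1 by exact: pS.
rewrite /sphere2 /= dot_stereo_inv !(dotC (stereo_inv _ _ _ _)).
rewrite !dot_stereo_inv hp (dotC e1 p) (dotC e2 p) (dotC e2 e1).
rewrite h11 h22 h12 h1 h2.
by move: hz; rewrite dot2 => hz; field.
Qed.

Lemma stereo_invK : cancel (stereo_inv p e1 e2) (stereo p e1 e2).
Proof.
have [h11 h22 h12 h1 h2] := pe => z; have hz := den_neq0 z.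
have hp : dot p p = 1 by exact: pS.
apply/rowP => i; rewrite !mxE !dot_stereo_inv hp h1 h2.
case: i => -[|[|//]] /= lti; rewrite ?(dotC e1 p) ?(dotC e2 p) ?(dotC e2 e1);
  rewrite ?h11 ?h22 ?h12 ?h1 ?h2.
- by rewrite (_ : Ordinal lti = 0) //; [field; lra | exact: val_inj].
- by rewrite (_ : Ordinal lti = 1) //; [field; lra | exact: val_inj].
Qed.

End StereoTheory.

(* f is of class C^k on the (open) set U: all its iterated partial derivatives
   up to order k exist and are continuous at every point of U. *)
Fixpoint class_C (R : realType) (n k : nat) (U : set 'rV[R]_n.+1)
    (f : 'rV[R]_n.+1 -> R) : Prop :=
  (forall z, U z -> {for z, continuous f}) /\
  if k is k'.+1 then
    forall i : 'I_n.+1, (forall z, U z -> derivable f z 'e_i)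
                        /\ class_C k' U ('D_('e_i) f)
  else True.

(* Only the values of rho on Omega matter. *)
Definition sphere_C2 (R : realType) (Omega : set 'rV[R]_3)
    (rho : 'rV[R]_3 -> R) : Prop :=
  forall q e1 e2 : 'rV[R]_3, sphere2 q -> tangent_frame q e1 e2 ->
    class_C 2 (stereo_inv q e1 e2 @^-1` Omega) (rho \o stereo_inv q e1 e2).

(* v is tangent at t and represents the differential of rho at t through the
   round metric: (rho o c)'(0) = <v, c'(0)> for every curve c of the sphere
   that passes through t at time 0 and is differentiable there. *)
Definition is_sphere_gradient (R : realType) (rho : 'rV[R]_3 -> R)
    (t v : 'rV[R]_3) : Prop :=
  dot t v = 0 /\
  forall c : R -> 'rV[R]_3, (forall s, sphere2 (c s)) -> c 0 = t ->
    derivable c 0 1 -> is_derive (0 : R) (1 : R) (rho \o c) (dot v ('D_1 c 0)).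

Definition sphere_gradient (R : realType) (rho : 'rV[R]_3 -> R)
    (t : 'rV[R]_3) : 'rV[R]_3 :=
  get [set v | is_sphere_gradient rho t v].

Definition horospherical_surface (R : realType) (rho : 'rV[R]_3 -> R)
    (t : 'rV[R]_3) : 'rV[R]_3 :=
  let D := sphere_gradient rho t in
  let q := dot D D + (expR (rho t) + 1) ^+ 2 in
  ((dot D D + (expR (2 * rho t) - 1)) / q) *: t + q^-1 *: (2 *: D).

(* The metric 4 |dx|^2 / (1 - |x|^2)^2 of the unit ball, at x. *)
Definition hyperbolic_metric (R : realType) (x u v : 'rV[R]_3) : R :=
  4 * dot u v / (1 - dot x x) ^+ 2.

(* Gram matrix, in the coordinate frame at z, of the pullback by F of h. *)
Definition pullback_metric (R : realType) (m n : nat)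
    (h : 'rV[R]_n.+1 -> 'rV[R]_n.+1 -> 'rV[R]_n.+1 -> R)
    (F : 'rV[R]_m.+1 -> 'rV[R]_n.+1) (z : 'rV[R]_m.+1) : 'M[R]_m.+1 :=
  \matrix_(i, j) h (F z) ('d F z 'e_i) ('d F z 'e_j).

Definition mx22 (R : realType) (a b c d : R) : 'M[R]_2 :=
  \matrix_(i < 2, j < 2)
    if i == 0 then (if j == 0 then a else b) else (if j == 0 then c else d).

(* Main.v *)
Require Import Defs.
From HB Require Import structures.
From mathcomp Require Import all_boot all_order all_algebra.
From mathcomp Require Import ring lra.
From mathcomp Require Import all_classical all_reals all_analysis.

Set Implicit Arguments.
Unset Strict Implicit.
Unset Printing Implicit Defensive.

Import Order.TTheory GRing.Theory Num.Theory.
Import numFieldNormedType.Exports.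

Local Open Scope classical_set_scope.
Local Open Scope ring_scope.

(** Why the formula holds. Let t be a point of the sphere, D the gradient of rho
    at t, W = exp (rho t), n = (W + 1) t - D and q = |n|^2 = |D|^2 + (W + 1)^2. The
    formula for R_rho says that R_rho t = t - 2 n / |n|^2. The map
    n |-> n / |n|^2 has derivative S / |n|^2, where S is the reflection along n.
    For a variation dt of t write df = <D, dt>; then dn = W df t + (W + 1) dt - dD,
    and dt = S (dt + 2 df n / q) because <n, dt> = - df. Therefore
      dR_rho = (2 / q) S ((q / 2 - W - 1) dt + df t - df D + dD).
    The component of dD along t is - df, since <t, D> = 0 along the variation, so
    the argument of S is tangent to the sphere. At p, where dt = v in the basis
    (e1, e2), it is W times A v, with A the matrix of the statement: this is
    [surface_velocity_reflection]. As S is an isometry, the Euclidean Gram matrix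
    of the differential is (2 W / q)^2 A^T A. Moreover 1 - |R_rho|^2 = 4 W / q, so
    the hyperbolic factor 4 / (1 - |R_rho|^2)^2 is (q / (2 W))^2 and the induced metric is
    A^T A. It equals A^2 because A is symmetric, that is because the mixed second
    derivatives of rho agree ([mixed_derivatives_commute]).

    To carry this out in the coordinates z = (x, y) centred at p, let E be the
    inverse stereographic projection and f = rho \o E. The gradient at E z is a
    combination of p, e1, e2 whose coefficients are polynomial in x, y and the
    partial derivatives of f ([is_sphere_gradient_stereo]); it is the only one
    ([sphere_gradient_unique]). Hence R_rho \o E is, near 0, an explicit smooth
    expression in z, f and the partial derivatives of f
    ([horospherical_surface_stereo]), all of which are differentiable at 0 because
    they have continuous partial derivatives ([is_diff_partials]). *)

(** * Derivatives along lines and mixed partial derivatives *)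

Section Line.
Variables (R : realType) (V : normedModType R).
Implicit Types (f : V -> R) (a v w : V).

Lemma is_derive_line f a v (t : R) : derivable f (a + t *: v) v ->
  is_derive t 1 (fun s : R => f (a + s *: v)) ('D_v f (a + t *: v)).
Proof.
have shiftE : (fun h : R => h^-1 *: (((fun s : R => f (a + s *: v)) \o shift t) (h *: 1)
    - f (a + t *: v))) =
    (fun h : R => h^-1 *: ((f \o shift (a + t *: v)) (h *: v) - f (a + t *: v))).
  apply/funext => h /=; congr (_ *: (f _ - _)).
  by rewrite [_%:A]mulr1 scalerDl addrCA.
move=> df; apply: DeriveDef; first by rewrite /derivable shiftE.
by rewrite /derive shiftE.
Qed.

(** The mean value theorem along the segment from [a] to [a + t *: v]; the
    parameter [t] may have any sign, which spares case distinctions below. *)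
Lemma MVT_line f a v (t : R) :
  (forall s, `|s| <= `|t| -> derivable f (a + s *: v) v) ->
  exists2 s, `|s| <= `|t| & f (a + t *: v) - f a = t * 'D_v f (a + s *: v).
Proof.
move=> df; pose g := fun s : R => f (a + s *: v).
have dg (s : R) : `|s| <= `|t| -> is_derive s 1 g ('D_v f (a + s *: v)).
  by move=> st; apply: is_derive_line; exact: df.
have cg (b c : R) : (forall s, s \in `[b, c]%R -> `|s| <= `|t|) ->
    {within `[b, c], continuous g}.
  move=> bc; apply: derivable_within_continuous => s /bc st.
  by have [] := dg _ st.
have g0 : f a = g 0 by rewrite /g scale0r addr0.
rewrite g0 -[f (a + t *: v)]/(g t).
have [t0|t0] := leP 0 t.
  have le s : s \in `[0, t]%R -> `|s| <= `|t|.
    by rewrite in_itv /= => /andP[s0 st]; rewrite !ger0_norm.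
  have dgt s s0t := dg s (le s (subset_itv_oo_cc s0t)).
  have [s /le st ->] := MVT_segment t0 dgt (cg _ _ le).
  by exists s => //; rewrite subr0 mulrC.
have le s : s \in `[t, 0]%R -> `|s| <= `|t|.
  by rewrite in_itv /= => /andP[s0 st]; rewrite !ler0_norm ?lerN2 // ltW.
have dgt s s0t := dg s (le s (subset_itv_oo_cc s0t)).
have [s /le st E] := MVT_segment (ltW t0) dgt (cg _ _ le).
by exists s => //; rewrite -opprB E sub0r mulrN opprK mulrC.
Qed.

Lemma is_derive_translate f a b v (l : R) :
  is_derive (a + b) v f l -> is_derive a v (fun z => f (z + b)) l.
Proof.
have shE : (fun h : R => h^-1 *: (((fun z => f (z + b)) \o shift a) (h *: v) - f (a + b)))
    = (fun h : R => h^-1 *: ((f \o shift (a + b)) (h *: v) - f (a + b))).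
  by apply/funext => h /=; rewrite -!addrA.
move=> [df <-]; apply: DeriveDef; first by rewrite /derivable shE.
by rewrite /derive shE.
Qed.

(** Two applications of the mean value theorem: first to the increment of [f]
    in the direction [w], along [v]; then to ['D_v f], along [w]. *)
Lemma second_difference f a v w (t : R) :
  (forall s s', `|s| <= `|t| -> `|s'| <= `|t| ->
    derivable f (a + s *: v + s' *: w) v /\
    derivable ('D_v f) (a + s *: v + s' *: w) w) ->
  exists s s', [/\ `|s| <= `|t|, `|s'| <= `|t| &
    f (a + t *: v + t *: w) - f (a + t *: v) - (f (a + t *: w) - f a) =
    t ^+ 2 * 'D_w ('D_v f) (a + s *: v + s' *: w)].
Proof.
move=> df; pose g z := f (z + t *: w) - f z.
have t0 : `|0 : R| <= `|t| by rewrite normr0.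
have dg s : `|s| <= `|t| -> is_derive (a + s *: v) v g
    ('D_v f (a + s *: v + t *: w) - 'D_v f (a + s *: v)).
  move=> st; apply: (@is_deriveB _ _ _ (fun z => f (z + t *: w)) f).
    apply: is_derive_translate; apply: derivableP.
    exact: (df s t st (lexx _)).1.
  apply: derivableP; have := (df s 0 st t0).1.
  by rewrite scale0r addr0.
have [|s st E1] := @MVT_line g a v t; first by move=> s /dg[].
have [_ E2] := dg _ st.
have [|s' st' E3] := @MVT_line ('D_v f) (a + s *: v) w t.
  by move=> s' st'; exact: (df s s' st st').2.
by exists s, s'; split => //; rewrite expr2 -mulrA -E3 -E2 -E1.
Qed.

(** The second difference of [f] is symmetric in [v] and [w], so for small [t]
    a value of ['D_w ('D_v f)] near [a] equals a value of ['D_v ('D_w f)] near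
    [a]; continuity at [a] forces both functions to agree there. *)
Lemma mixed_derivatives_commute f a v w :
  (\forall z \near a, derivable f z v /\ derivable ('D_v f) z w) ->
  (\forall z \near a, derivable f z w /\ derivable ('D_w f) z v) ->
  {for a, continuous ('D_w ('D_v f))} -> {for a, continuous ('D_v ('D_w f))} ->
  'D_w ('D_v f) a = 'D_v ('D_w f) a.
Proof.
move=> dvw dwv cvw cwv; apply/eqP/negPn/negP => neq.
set P : V -> R := 'D_w ('D_v f) in cvw neq.
set Q : V -> R := 'D_v ('D_w f) in cwv neq.
have e0 : 0 < `|P a - Q a| / 2 by rewrite divr_gt0 // normr_gt0 subr_eq0.
have /(_ _ _ e0) nP := (@cvgrPdist_lt _ _ _ _ _ P (P a)).1 cvw.
have /(_ _ _ e0) nQ := (@cvgrPdist_lt _ _ _ _ _ Q (Q a)).1 cwv.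
have [d /= d0 dP] := (nbhs_ballP _ _).1 (filterI (filterI dvw dwv) (filterI nP nQ)).
(* The summand 1 keeps [k] positive when [v] and [w] both vanish. *)
pose k := `|v| + `|w| + 1.
have k0 : 0 < k by rewrite ltr_wpDl // addr_ge0.
have [t t0 tk] : exists2 t, 0 < t & t * k < d.
  exists (d / (2 * k)); first by rewrite divr_gt0 // mulr_gt0.
  have -> : d / (2 * k) * k = d / 2 by field; rewrite gt_eqF.
  by rewrite ltr_pdivrMr // ltr_pMr // ltr1n.
have near_a s s' : `|s| <= `|t| -> `|s'| <= `|t| -> ball a d (a + s *: v + s' *: w).
  rewrite (gtr0_norm t0) => st st'.
  rewrite -ball_normE /ball_ /= -addrA opprD addNKr normrN.
  apply: le_lt_trans (ler_normD _ _) _; rewrite !normrZ.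
  apply: le_lt_trans tk.
  apply: (@le_trans _ _ (t * `|v| + t * `|w|)); first by rewrite lerD ?ler_wpM2r.
  by rewrite -mulrDr ler_pM2l // /k lerDl.
pose Delta := f (a + t *: v + t *: w) - f (a + t *: v) - (f (a + t *: w) - f a).
have [z1 z1a E1] : exists2 z, ball a d z & Delta = t ^+ 2 * P z.
  have [|s [s' [st st' E]]] := @second_difference f a v w t.
    by move=> s s' st st'; exact: (dP _ (near_a _ _ st st')).1.1.
  by exists (a + s *: v + s' *: w); first exact: near_a.
have [z2 z2a E2] : exists2 z, ball a d z & Delta = t ^+ 2 * Q z.
  have DeltaC : Delta =
      f (a + t *: w + t *: v) - f (a + t *: w) - (f (a + t *: v) - f a).
    rewrite /Delta [a + t *: w + _]addrAC !opprB addrACA [RHS]addrACA.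
    by congr (_ + _); rewrite addrC.
  have [|s [s' [st st' E]]] := @second_difference f a w v t.
    move=> s s' st st'; rewrite addrAC.
    exact: (dP _ (near_a _ _ st' st)).1.2.
  exists (a + s *: w + s' *: v); last by rewrite DeltaC.
  by rewrite addrAC; exact: near_a.
have PQ : P z1 = Q z2.
  have t2 : t ^+ 2 != 0 by rewrite expf_neq0 // gt_eqF.
  by apply: (mulfI t2); exact: eq_trans (esym E1) E2.
have [_ [/= ltP _]] := dP _ z1a.
have [_ [/= _ ltQ]] := dP _ z2a.
rewrite -PQ in ltQ; move: ltP ltQ.
move: (P a) (Q a) (P z1) => x y z xz yz.
have : `|x - y| < `|x - y|.
  rewrite [ltRHS]splitr; apply: le_lt_trans (ltrD xz yz).
  by rewrite (distrC y); exact: ler_distD.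
by rewrite ltxx.
Qed.

End Line.

(** * Functions of class C^1 are differentiable *)

(** The little-o in the definition of the differential, stated as an
    inequality, so that it can be checked by estimates. *)
Lemma is_diff_expansion (R : realType) (V W : normedModType R) (f : V -> W)
    (L : {linear V -> W}) (a : V) : continuous L ->
  (forall e : R, 0 < e ->
    \forall h \near (0 : V), `|f (h + a) - (f a + L h)| <= e * `|h|) ->
  is_diff a f L.
Proof.
move=> Lc fL.
have expand : f \o shift a = cst (f a) + (L : V -> W) +o_ (0 : V) id.
  exact/eqaddoP.
have dE := diff_unique Lc expand.
by split => //; apply/diff_locallyP; rewrite dE.
Qed.

Section Plane.
Variable R : realType.
Implicit Types (f : 'rV[R]_2 -> R) (a z h : 'rV[R]_2).

Lemma row2E z : z = z 0 0 *: 'e_0 + z 0 1 *: 'e_1.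
Proof.
rewrite [LHS]row_sum_delta !big_ord_recl big_ord0 addr0.
by rewrite (_ : lift ord0 ord0 = 1) //; exact: val_inj.
Qed.

Lemma norm_coord z i : `|z 0 i| <= `|z|.
Proof. by rewrite [leRHS]/Num.Def.normr/= mx_normrE; exact: (le_bigmax _ _ (0, i)). Qed.

Lemma norm_row2_le (s t r : R) : `|s| <= r -> `|t| <= r ->
  `|s *: 'e_0 + t *: 'e_1 : 'rV[R]_2| <= r.
Proof.
move=> sr tr; rewrite [leLHS]/Num.Def.normr/= mx_normrE.
apply: bigmax_le => [|[i j] _]; first exact: le_trans sr.
rewrite !mxE /= (ord1 i) eqxx /=.
by case: j => -[|[|//]] /= ltj; rewrite ?mulr0 ?mulr1 ?addr0 ?add0r.
Qed.

(** The increment of [f] is split along the broken line from [a] to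
    [a + h 0 1 *: 'e_1] to [a + h]; on each leg the mean value theorem gives a
    partial derivative at an intermediate point, close to its value at [a]. The
    norm of ['rV_2] is the sup norm, hence these points stay in any ball that
    contains [a + h]. *)
Lemma is_diff_partials f a :
  (\forall z \near a, derivable f z 'e_0 /\ derivable f z 'e_1) ->
  {for a, continuous ('D_'e_0 f)} -> {for a, continuous ('D_'e_1 f)} ->
  is_diff a f (fun h => h 0 0 * 'D_'e_0 f a + h 0 1 * 'D_'e_1 f a).
Proof.
move=> df c0 c1; set A := 'D_'e_0 f a; set B := 'D_'e_1 f a.
pose d h : R := h 0 0 * A + h 0 1 * B.
have lin_d : linear d by move=> k u v; rewrite /d !mxE /GRing.scale /=; ring.
pose dM := GRing.isLinear.Build _ _ _ _ _ lin_d.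
pose L : {linear _ -> _} := HB.pack d dM.
have Lc : continuous L.
  have Mc i c : continuous (fun h : 'rV[R]_2 => h 0 i * c : R).
    move=> z; apply: (@continuousM _ _ (fun h : 'rV[R]_2 => h 0 i : R) (cst c)).
      exact: coord_continuous.
    exact: cst_continuous.
  move=> z; apply: (@continuousD _ _ _ (fun h => h 0 0 * A : R) (fun h => h 0 1 * B : R));
    exact: Mc.
apply: (@is_diff_expansion _ _ _ f L a Lc) => e e0.
have e20 : 0 < e / 2 by rewrite divr_gt0.
have /(_ _ _ e20) n0 := (@cvgrPdist_lt _ _ _ _ _ ('D_'e_0 f) A).1 c0.
have /(_ _ _ e20) n1 := (@cvgrPdist_lt _ _ _ _ _ ('D_'e_1 f) B).1 c1.
have [r /= r0 dP] := (nbhs_ballP _ _).1 (filterI df (filterI n0 n1)).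
near=> h.
have hr : `|h| < r by near: h; exact: (@nbhs0_lt _ 'rV[R]_2 r r0).
have in_ball s t : `|s| <= `|h| -> `|t| <= `|h| ->
    ball a r (a + s *: 'e_0 + t *: 'e_1).
  move=> st tt; rewrite -ball_normE /ball_ /= -addrA opprD addNKr normrN.
  by apply: le_lt_trans hr; exact: norm_row2_le.
have h00 : `|0 : R| <= `|h| by rewrite normr0.
have [|s /le_trans/(_ (norm_coord _ _)) sh E1] :=
    @MVT_line _ _ f (a + h 0 1 *: 'e_1) 'e_0 (h 0 0).
  move=> s /le_trans/(_ (norm_coord _ _)) sh; rewrite addrAC.
  exact: (dP _ (in_ball _ _ sh (norm_coord _ _))).1.1.
have [|t /le_trans/(_ (norm_coord _ _)) th E2] :=
    @MVT_line _ _ f a 'e_1 (h 0 1).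
  move=> t /le_trans/(_ (norm_coord _ _)) th.
  by have := (dP _ (in_ball _ _ h00 th)).1.2; rewrite scale0r addr0.
have [_ [/= + _]] := dP _ (in_ball _ _ sh (norm_coord h 1)).
have [_ [/= _ +]] := dP _ (in_ball _ _ h00 th).
rewrite scale0r addr0 addrAC => tB sA.
have -> : f (h + a) - (f a + L h) =
   h 0 0 * ('D_'e_0 f (a + h 0 1 *: 'e_1 + s *: 'e_0) - A)
   + h 0 1 * ('D_'e_1 f (a + t *: 'e_1) - B).
  rewrite !mulrBr -E1 -E2 -[L h]/(d h) /d.
  rewrite [in LHS](addrC h) [in f _](row2E h) [h 0 0 *: _ + _]addrC addrA.
  by move: (f _) (f _) (f _) => u v w; ring.
rewrite (le_trans (ler_normD _ _)) // [e]splitr mulrDl.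
apply: lerD; rewrite normrM mulrC; apply: ler_pM; rewrite ?norm_coord ?normr_ge0 //.
  by rewrite distrC; exact: ltW sA.
by rewrite distrC; exact: ltW tB.
Unshelve. all: by end_near. Qed.

End Plane.

Lemma class_C_le (R : realType) n k (U : set 'rV[R]_n.+1) (f : 'rV[R]_n.+1 -> R) :
  class_C k.+1 U f -> class_C k U f.
Proof.
elim: k f => [|k IHk] f [cf df]; first by split.
split=> // i; split; first by have [] := df i.
by apply: IHk; have [] := df i.
Qed.

Lemma class_C1_is_diff (R : realType) (U : set 'rV[R]_2) (f : 'rV[R]_2 -> R) z :
  open U -> U z -> class_C 1 U f ->
  is_diff z f (fun h => h 0 0 * 'D_'e_0 f z + h 0 1 * 'D_'e_1 f z).
Proof.
move=> oU Uz [_ df]; apply: is_diff_partials; last 2 first.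
- by have [_ [c0 _]] := df 0; exact: c0.
- by have [_ [c1 _]] := df 1; exact: c1.
apply: filterS (open_nbhs_nbhs (conj oU Uz)) => w Uw.
by split; [apply: (df 0).1 | apply: (df 1).1].
Qed.

Lemma class_C2_mixed_derivatives (R : realType) (U : set 'rV[R]_2) (f : 'rV[R]_2 -> R) z :
  open U -> U z -> class_C 2 U f -> 'D_'e_1 ('D_'e_0 f) z = 'D_'e_0 ('D_'e_1 f) z.
Proof.
move=> oU Uz [_ df]; have [d0 [_ dd0]] := df 0; have [d1 [_ dd1]] := df 1.
have UN : \forall w \near z, U w by exact: open_nbhs_nbhs.
apply: mixed_derivatives_commute.
- by apply: filterS UN => w Uw; split; [exact: d0 | exact: (dd0 1).1].
- by apply: filterS UN => w Uw; split; [exact: d1 | exact: (dd1 0).1].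
- exact: (dd0 1).2.1.
- exact: (dd1 0).2.1.
Qed.

(** * Differentials and derivatives of explicit expressions *)

Lemma near_eq_is_diff (R : realType) (V W : normedModType R)
    (f g df : V -> W) (a : V) :
  {near a, f =1 g} -> is_diff a f df -> is_diff a g df.
Proof.
move=> fg [fa <-]; have /eqaddoP fL := diff_locally fa.
apply: (@is_diff_expansion _ _ _ g ('d f a) a) => [|e e0].
  exact: diff_continuous.
have := fL e e0; rewrite !near_simpl; apply: filter_app.
near=> h => /=.
have <- : f (h + a) = g (h + a).
  near: h; move: fg; rewrite (near_shift 0) /=.
  by apply: filterS => h /=; rewrite subr0.
by rewrite (nbhs_singleton fg).
Unshelve. all: by end_near. Qed.

Lemma is_diff_inv (R : realType) (V : normedModType R) (f df : V -> R) (a : V) :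
  f a != 0 -> is_diff a f df ->
  is_diff a (fun z => (f z)^-1) (fun v => - (df v / f a ^+ 2)).
Proof.
move=> fa0 [fa <-]; apply: DiffDef; first exact: differentiableV.
by rewrite diffV //; apply/funext => v; rewrite [LHS]mulNr mulrC.
Qed.

(** The rules of differentiation with both the function and its differential
    as explicit abstractions. Stated with the ring operations on functions they
    leave terms in which the tactic [field] does not see the operations. *)
Section PointwiseDiff.
Variables (R : realType) (V : normedModType R) (a : V).
Implicit Types u v du dv : V -> R.

Lemma is_diff_addf u v du dv : is_diff a u du -> is_diff a v dv ->
  is_diff a (fun z => u z + v z) (fun w => du w + dv w).
Proof. by move=> u' v'; exact: (is_diffD u' v'). Qed.

Lemma is_diff_subf u v du dv : is_diff a u du -> is_diff a v dv ->
  is_diff a (fun z => u z - v z) (fun w => du w - dv w).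
Proof. by move=> u' v'; exact: (is_diffB u' v'). Qed.

Lemma is_diff_mulf u v du dv : is_diff a u du -> is_diff a v dv ->
  is_diff a (fun z => u z * v z) (fun w => u a * dv w + v a * du w).
Proof. by move=> u' v'; exact: (is_diffM u' v'). Qed.

Lemma is_diff_scalf (c : R) u du : is_diff a u du ->
  is_diff a (fun z => c * u z) (fun w => c * du w).
Proof. by move=> u'; exact: (is_diffZ c u'). Qed.

Lemma is_diff_cstf (c : R) : is_diff a (fun=> c) (fun=> 0).
Proof. exact: is_diff_cst. Qed.

Lemma is_diff_divf u v du dv : is_diff a u du -> is_diff a v dv -> v a != 0 ->
  is_diff a (fun z => u z / v z) (fun w => du w / v a - u a * dv w / v a ^+ 2).
Proof.
move=> u' v' va; apply: (is_diff_eq (is_diff_mulf u' (is_diff_inv va v'))).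
by apply/funext => w; field.
Qed.

Lemma is_diff_sqrf u du : is_diff a u du ->
  is_diff a (fun z => u z ^+ 2) (fun w => 2 * (u a * du w)).
Proof.
move=> u'; apply: (is_diff_eq (is_diff_mulf u' u')).
by apply/funext => w; ring.
Qed.

End PointwiseDiff.

Lemma is_diff_scale (R : realType) (V W : normedModType R) (k dk : V -> R)
    (w : W) (a : V) :
  is_diff a k dk -> is_diff a (fun z => k z *: w) (fun v => dk v *: w).
Proof.
move=> [ka <-]; apply: DiffDef; first exact: differentiableZl.
by rewrite diffZl.
Qed.

Lemma is_diff_expR (R : realType) (x : R) :
  is_diff x expR (fun v : R => v * expR x).
Proof.
have dx : derivable expR x (1 : R) by exact: derivable_expR.
apply: DiffDef; first exact/derivable1_diffP.
by rewrite deriv1E // derive1E derive_val.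
Qed.

Lemma is_diff_coord (R : realType) n (i : 'I_n.+1) (a : 'rV[R]_n.+1) :
  is_diff a (fun z : 'rV[R]_n.+1 => z 0 i : R) (fun v => v 0 i).
Proof.
pose c (z : 'rV[R]_n.+1) : R := z 0 i.
have lin_c : linear c by move=> k u v; rewrite /c !mxE.
pose cM := GRing.isLinear.Build _ _ _ _ _ lin_c.
pose L : {linear _ -> _} := HB.pack c cM.
have Lc : continuous L by exact: coord_continuous.
apply: (@DiffDef _ _ _ _ _ c c).
  exact: (@linear_differentiable _ _ _ L).
exact: (@diff_lin _ _ _ L).
Qed.

Lemma is_derive_comp_diff (R : realType) (V W : normedModType R)
    (w : R -> V) (f df : V -> W) (t : R) (dw : V) :
  is_derive t 1 w dw -> is_diff (w t) f df -> is_derive t 1 (f \o w) (df dw).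
Proof.
move=> [w1 <-] fw.
have wt : differentiable w t by exact/derivable1_diffP.
have fwt : differentiable (f \o w) t by apply: differentiable_comp.
apply: DeriveDef; first exact/derivable1_diffP.
by rewrite !deriveE // diff_comp //= diff_val.
Qed.

Lemma is_derive_div (R : realType) (u v : R -> R) (t u' v' : R) : v t != 0 ->
  is_derive t 1 u u' -> is_derive t 1 v v' ->
  is_derive t 1 (fun s => u s / v s) ((u' * v t - u t * v') / v t ^+ 2).
Proof.
move=> v0 du dv; have dV := is_deriveV v0 dv.
apply: is_derive_eq; rewrite /GRing.scale /=.
by field.
Qed.

Lemma is_derive_mx (R : realType) (V : normedModType R) (m n : nat)
    (M : V -> 'M[R]_(m, n)) (t v : V) (dM : 'M[R]_(m, n)) :
  (forall i j, is_derive t v (fun s => M s i j) (dM i j)) -> is_derive t v M dM.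
Proof.
move=> dMij; have dM' : derivable M t v.
  by apply/derivable_mxP => i j; case: (dMij i j).
apply: DeriveDef => //; rewrite derive_mx //.
by apply/matrixP => i j; rewrite mxE; case: (dMij i j).
Qed.

(** * Euclidean geometry of an orthonormal frame *)

Section Dot.
Variables (R : realType) (n : nat).
Implicit Types u v w : 'rV[R]_n.

Lemma dotDl u v w : dot (u + v) w = dot u w + dot v w.
Proof. by rewrite dotC dotDr !(dotC w). Qed.

Lemma dotZl (a : R) u v : dot (a *: u) v = a * dot u v.
Proof. by rewrite dotC dotZr (dotC v). Qed.

Lemma dotBl u v w : dot (u - v) w = dot u w - dot v w.
Proof. by rewrite dotDl -scaleN1r dotZl mulN1r. Qed.

Lemma dot_eq0 u : dot u u = 0 -> u = 0.
Proof.
move=> /eqP; rewrite psumr_eq0; last by move=> i _; rewrite -expr2 sqr_ge0.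
move=> /allP u0; apply/rowP => i; rewrite mxE; apply/eqP.
by have := u0 i (mem_index_enum i); rewrite mulf_eq0 orbb.
Qed.

Definition reflect_along w u : 'rV[R]_n := u - (2 * dot w u / dot w w) *: w.

Lemma dot_reflect_along w u v : dot w w != 0 ->
  dot (reflect_along w u) (reflect_along w v) = dot u v.
Proof.
move=> w0; rewrite /reflect_along -!(scaleNr _ w) !(dotDl, dotDr, dotZl, dotZr) (dotC u w).
by field.
Qed.

End Dot.

Lemma is_derive_dot (R : realType) n (u : 'rV[R]_n.+1) (c : R -> 'rV[R]_n.+1) (t : R) :
  derivable c t 1 -> is_derive t 1 (fun s => dot u (c s)) (dot u ('D_1 c t)).
Proof.
move=> dc.
have dci i : is_derive t 1 (fun s => c s 0 i) ('D_1 c t 0 i).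
  by rewrite derive_mx // mxE; apply: derivableP; exact: (derivable_mxP _ _ _).1.
have -> : (fun s => dot u (c s)) = \sum_(i < n.+1) (u 0 i *: (fun s => c s 0 i : R)).
  by apply/funext => s; rewrite fct_sumE.
exact: is_derive_sum.
Qed.

Section Frame.
Variables (R : realType) (p e1 e2 : 'rV[R]_3).
Hypotheses (pS : sphere2 p) (pe : tangent_frame p e1 e2).
Implicit Types (t v : 'rV[R]_3) (z : 'rV[R]_2).

Definition frame_comb (a b c : R) : 'rV[R]_3 := a *: p + b *: e1 + c *: e2.

Lemma dot_frame_comb a b c a' b' c' :
  dot (frame_comb a b c) (frame_comb a' b' c') = a * a' + b * b' + c * c'.
Proof.
have [h11 h22 h12 h1 h2] := pe; have hp : dot p p = 1 by exact: pS.
rewrite /frame_comb !(dotDl, dotDr, dotZl, dotZr) (dotC e1 p) (dotC e2 p).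
by rewrite (dotC e2 e1) hp h11 h22 h12 h1 h2; ring.
Qed.

Lemma frame_combDZ (k l a b c a' b' c' : R) :
  k *: frame_comb a b c + l *: frame_comb a' b' c' =
  frame_comb (k * a + l * a') (k * b + l * b') (k * c + l * c').
Proof.
by rewrite /frame_comb !(scalerDr, scalerA) addrACA [X in X + _]addrACA -!scalerDl.
Qed.

Lemma frame_combZ (k a b c : R) :
  k *: frame_comb a b c = frame_comb (k * a) (k * b) (k * c).
Proof. by rewrite /frame_comb !(scalerDr, scalerA). Qed.

Lemma reflect_along_frame_comb (N g h k l : R) (q := N ^+ 2 + (g ^+ 2 + h ^+ 2)) :
  reflect_along (frame_comb N (- g) (- h)) (frame_comb 0 k l) =
  frame_comb (2 * N * (g * k + h * l) / q)
    (k - 2 * g * (g * k + h * l) / q) (l - 2 * h * (g * k + h * l) / q).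
Proof.
have qE : N * N + - g * - g + - h * - h = q by rewrite /q; ring.
rewrite /reflect_along !dot_frame_comb // qE -[X in X - _]scale1r -scaleNr.
by rewrite frame_combDZ; congr frame_comb; ring.
Qed.

(** The matrix with rows [p], [e1], [e2] satisfies [M *m M^T = 1], hence also
    [M^T *m M = 1], which is the expansion of [t] in the frame. *)
Lemma frame_coord t : t = frame_comb (dot p t) (dot e1 t) (dot e2 t).
Proof.
have [h11 h22 h12 h1 h2] := pe; have hp : dot p p = 1 by exact: pS.
pose F (i : 'I_3) := if val i == 0%N then p else if val i == 1%N then e1 else e2.
pose M : 'M[R]_3 := \matrix_(i < 3) F i.
have MT : M *m M^T = 1%:M.
  apply/matrixP => i j; rewrite !mxE.
  have -> : \sum_(k < 3) M i k * M^T k j = dot (F i) (F j).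
    by apply: eq_bigr => k _; rewrite !mxE.
  by case: i => -[|[|[|//]]] lti; case: j => -[|[|[|//]]] ltj; rewrite /F /=;
    rewrite ?(dotC e1 p) ?(dotC e2 p) ?(dotC e2 e1) ?hp ?h11 ?h22 ?h12 ?h1 ?h2.
rewrite -[LHS]mulmx1 -(mulmx1C MT) mulmxA mulmx_sum_row.
rewrite !big_ord_recl big_ord0 addr0 !rowK addrA /frame_comb /F /=.
by congr (_ *: _ + _ *: _ + _ *: _); rewrite mxE dotC; apply: eq_bigr => k _;
  rewrite !mxE.
Qed.

Lemma sphere2_coord t : sphere2 t ->
  dot p t ^+ 2 + dot e1 t ^+ 2 + dot e2 t ^+ 2 = 1.
Proof. by rewrite /sphere2 /= {1 2}(frame_coord t) dot_frame_comb -!expr2. Qed.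

Lemma dot_row2 z : dot z z = z 0 0 ^+ 2 + z 0 1 ^+ 2.
Proof.
rewrite /dot !big_ord_recl big_ord0 addr0 !expr2.
by rewrite (_ : lift ord0 ord0 = 1) //; exact: val_inj.
Qed.

Lemma stereo_invE z : stereo_inv p e1 e2 z =
  frame_comb ((4 - dot z z) / (4 + dot z z)) (4 * z 0 0 / (4 + dot z z))
    (4 * z 0 1 / (4 + dot z z)).
Proof.
rewrite /stereo_inv /frame_comb !(scalerDr, scalerA) addrA.
by congr (_ *: _ + _ *: _ + _ *: _); ring.
Qed.

(** The only point of the sphere that the coordinates miss is [- p], where the
    denominator of [stereo] vanishes. *)
Lemma stereoK t : sphere2 t -> 1 + dot p t != 0 ->
  stereo_inv p e1 e2 (stereo p e1 e2 t) = t.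
Proof.
move=> /sphere2_coord tS t1; rewrite stereo_invE dot_row2 !mxE /=.
apply: eq_trans (esym (frame_coord t)); move: tS t1.
move: (dot p t) (dot e1 t) (dot e2 t) => a b c abc a1.
have sE : (2 * b / (1 + a)) ^+ 2 + (2 * c / (1 + a)) ^+ 2 = 4 * (1 - a) / (1 + a).
  have cE : c ^+ 2 = 1 - a ^+ 2 - b ^+ 2 by rewrite -abc; ring.
  by rewrite !expr_div_n !exprMn cE; field.
rewrite sE.
have E4 : 4 + 4 * (1 - a) / (1 + a) = 8 / (1 + a) by field.
rewrite E4; congr frame_comb; by field.
Qed.

End Frame.

Lemma is_diff_frame_comb (R : realType) (V : normedModType R)
    (p e1 e2 : 'rV[R]_3) (a b c da db dc : V -> R) (z : V) :
  is_diff z a da -> is_diff z b db -> is_diff z c dc ->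
  is_diff z (fun w => frame_comb p e1 e2 (a w) (b w) (c w))
    (fun v => frame_comb p e1 e2 (da v) (db v) (dc v)).
Proof.
move=> za zb zc.
exact: (is_diffD (is_diffD (is_diff_scale p za) (is_diff_scale e1 zb))
  (is_diff_scale e2 zc)).
Qed.

Lemma continuous_stereo_inv (R : realType) (p e1 e2 : 'rV[R]_3) :
  continuous (stereo_inv p e1 e2).
Proof.
move=> z; apply: differentiable_continuous.
have d4 (w : 'rV[R]_2) : 4 + dot w w != 0.
  by rewrite gt_eqF // ltr_pwDl ?dot_ge0 // ltr0n.
pose X (w : 'rV[R]_2) : R := w 0 0; pose Y (w : 'rV[R]_2) : R := w 0 1.
have dX : is_diff z X X by exact: is_diff_coord.
have dY : is_diff z Y Y by exact: is_diff_coord.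
pose S : 'rV[R]_2 -> R := cst 4 + (X * X + Y * Y).
have SE w : 4 + dot w w = S w by rewrite dot_row2 !expr2.
have dS : differentiable S z.
  by case: (is_diffD (is_diff_cst (4 : R) z) (is_diffD (is_diffM dX dX) (is_diffM dY dY))).
pose k w := (S w)^-1.
have Sz : S z != 0 by rewrite -SE.
have dk : is_diff z k _ := is_diff_inv Sz (differentiableP dS).
have -> : stereo_inv p e1 e2 = fun w => frame_comb p e1 e2
    (((cst 8 - S) * k) w) ((4 *: X * k) w) ((4 *: Y * k) w).
  apply/funext => w; rewrite stereo_invE.
  have -> : 4 - dot w w = 8 - S w by rewrite -SE; ring.
  by rewrite !SE.
have da : differentiable ((cst 8 - S) * k) z.
  by case: (is_diffM (is_diffB (is_diff_cst (8 : R) z) (differentiableP dS)) dk).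
have db : differentiable (4 *: X * k) z.
  by case: (is_diffM (is_diffZ 4 dX) dk).
have dc : differentiable (4 *: Y * k) z.
  by case: (is_diffM (is_diffZ 4 dY) dk).
by case: (is_diff_frame_comb p e1 e2 (differentiableP da)
  (differentiableP db) (differentiableP dc)).
Qed.

(** * The gradient on the sphere in stereographic coordinates *)

Section Gradient.
Variables (R : realType) (p e1 e2 : 'rV[R]_3).
Hypotheses (pS : sphere2 p) (pe : tangent_frame p e1 e2).
Implicit Types (t v : 'rV[R]_3) (z : 'rV[R]_2).

(** The vector (4 + |z|^2)^2 / 16 (g E_x + h E_y), where E is the inverse
    stereographic projection: the factor is the inverse of the round metric, and
    it cancels the denominators of E_x and E_y. *)
Definition stereo_gradient (z : 'rV[R]_2) (g h : R) : 'rV[R]_3 :=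
  frame_comb p e1 e2
    (- (z 0 0 * g + z 0 1 * h))
    ((1 + (z 0 1 ^+ 2 - z 0 0 ^+ 2) / 4) * g - z 0 0 * z 0 1 / 2 * h)
    ((1 + (z 0 0 ^+ 2 - z 0 1 ^+ 2) / 4) * h - z 0 0 * z 0 1 / 2 * g).

Lemma dot_stereo_gradient z g h :
  dot (stereo_gradient z g h) (stereo_gradient z g h) =
  ((4 + dot z z) / 4) ^+ 2 * (g ^+ 2 + h ^+ 2).
Proof. by rewrite dot_frame_comb // dot_row2; field. Qed.

(** A curve [c] on the sphere through E z stays away from [- p] for small
    times, so it is E \o w for its coordinates [w], and the chain rule applies to
    rho \o c = (rho \o E) \o w. The coefficients along [p], [e1], [e2] of the
    velocity of [c] satisfy the tangency relation coming from |c|^2 = 1; modulo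
    this relation the chain rule gives the inner product with the gradient. *)
Lemma is_sphere_gradient_stereo (rho : 'rV[R]_3 -> R) z (g h : R) :
  is_diff z (rho \o stereo_inv p e1 e2) (fun w => w 0 0 * g + w 0 1 * h) ->
  is_sphere_gradient rho (stereo_inv p e1 e2 z) (stereo_gradient z g h).
Proof.
move=> df; have d4 : 4 + dot z z != 0.
  by rewrite gt_eqF // ltr_pwDl ?dot_ge0 // ltr0n.
split=> [|c cS c0 dc].
  by rewrite stereo_invE dot_frame_comb //; move: d4; rewrite dot_row2 => d4; field.
set c' := 'D_1 c 0.
pose A s := dot p (c s); pose B s := dot e1 (c s); pose C s := dot e2 (c s).
have dA : is_derive (0 : R) (1 : R) A (dot p c') by exact: is_derive_dot.
have dB : is_derive (0 : R) (1 : R) B (dot e1 c') by exact: is_derive_dot.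
have dC : is_derive (0 : R) (1 : R) C (dot e2 c') by exact: is_derive_dot.
have pp : dot p p = 1 by exact: pS.
have [h11 h22 h12 h1 h2] := pe.
have A0 : 1 + A 0 = 8 / (4 + dot z z).
  by rewrite /A c0 dot_stereo_inv pp h1 h2; field.
have B0 : B 0 = 4 * z 0 0 / (4 + dot z z).
  by rewrite /B c0 dot_stereo_inv (dotC e1 p) h1 h11 h12; field.
have C0 : C 0 = 4 * z 0 1 / (4 + dot z z).
  by rewrite /C c0 dot_stereo_inv (dotC e2 p) (dotC e2 e1) h2 h12 h22; field.
have A1 : 1 + A 0 != 0 by rewrite A0 mulf_neq0 ?invr_eq0.
have dA1 : is_derive (0 : R) (1 : R) (fun s => 1 + A s) (dot p c').
  by apply: is_derive_eq; rewrite add0r mul1r.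
pose w s := stereo p e1 e2 (c s).
pose dw : 'rV[R]_2 :=
  (2 * ((dot e1 c' * (1 + A 0) - B 0 * dot p c') / (1 + A 0) ^+ 2)) *: 'e_0 +
  (2 * ((dot e2 c' * (1 + A 0) - C 0 * dot p c') / (1 + A 0) ^+ 2)) *: 'e_1.
have w0 : w 0 = z by rewrite /w c0 stereo_invK.
have dwP : is_derive (0 : R) (1 : R) w dw.
  apply: is_derive_mx => i j; rewrite (ord1 i) !mxE /=.
  have dBA := @is_derive_div _ B (fun s => 1 + A s) 0 _ _ A1 dB dA1.
  have dCA := @is_derive_div _ C (fun s => 1 + A s) 0 _ _ A1 dC dA1.
  case: j => -[|[|//]] ltj.
  - have -> : (fun s : R => w s 0 (Ordinal ltj)) = 2 *: (fun s => B s / (1 + A s)).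
      by apply/funext => s; rewrite !mxE /= -mulrA.
    by apply: is_derive_eq; rewrite /GRing.scale /= mulr0 addr0 mulr1.
  - have -> : (fun s : R => w s 0 (Ordinal ltj)) = 2 *: (fun s => C s / (1 + A s)).
      by apply/funext => s; rewrite !mxE /= -mulrA.
    by apply: is_derive_eq; rewrite /GRing.scale /= mulr0 add0r mulr1.
have rhoE : \forall s \near (0 : R),
    ((rho \o stereo_inv p e1 e2) \o w) s = (rho \o c) s.
  have A1c : {for 0, continuous (fun s => 1 + A s)}.
    by apply/differentiable_continuous/derivable1_diffP; case: dA1.
  near=> s; rewrite /= stereoK //.
  near: s; exact: (cvgr_neq0 _ A1c A1).
apply: near_eq_is_derive rhoE _.
have dfw : is_diff (w 0) (rho \o stereo_inv p e1 e2)
    (fun w => w 0 0 * g + w 0 1 * h) by rewrite w0.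
have tangency : A 0 * dot p c' + B 0 * dot e1 c' + C 0 * dot e2 c' = 0.
  have dS := is_deriveD (is_deriveD (is_deriveM dA dA) (is_deriveM dB dB))
    (is_deriveM dC dC).
  have SE : A * A + B * B + C * C = cst 1.
    by apply/funext => s; rewrite -[RHS](sphere2_coord pS pe (cS s)) !expr2.
  move: dS; rewrite SE => -[_]; rewrite derive_cst /GRing.scale /=.
  move: (A 0) (B 0) (C 0) (dot p c') (dot e1 c') (dot e2 c') => *; lra.
apply: (is_derive_eq (is_derive_comp_diff dwP dfw)).
rewrite /dw !mxE /= !mulr0 !mulr1 addr0 add0r.
have -> : dot (stereo_gradient z g h) c' =
    - (z 0 0 * g + z 0 1 * h) * dot p c' +
    ((1 + (z 0 1 ^+ 2 - z 0 0 ^+ 2) / 4) * g - z 0 0 * z 0 1 / 2 * h) * dot e1 c' +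
    ((1 + (z 0 0 ^+ 2 - z 0 1 ^+ 2) / 4) * h - z 0 0 * z 0 1 / 2 * g) * dot e2 c'.
  by rewrite !dotDl !dotZl.
have A0' : A 0 = 8 / (4 + dot z z) - 1 by rewrite -A0 addrC addKr.
rewrite A0' B0 C0 in tangency; rewrite A0 B0 C0.
(* The two sides differ by this multiple of the tangency relation. *)
rewrite -[RHS]addr0 -(mulr0 ((z 0 0 * g + z 0 1 * h) * (4 + dot z z) / 8)).
rewrite -tangency; move: d4; rewrite dot_row2.
move: (z 0 0) (z 0 1) (dot p c') (dot e1 c') (dot e2 c') => x y a b b' d4.
by field; rewrite d4.
Unshelve. all: by end_near. Qed.

(** Two gradients have the same inner product with every tangent vector; it
    suffices to test on their difference [w], the velocity at time 0 of a
    rationally parametrized great circle. *)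
Lemma sphere_gradient_unique (rho : 'rV[R]_3 -> R) t v v' : sphere2 t ->
  is_sphere_gradient rho t v -> is_sphere_gradient rho t v' -> v = v'.
Proof.
move=> tS [tv dv] [tv' dv']; have [w wE] : exists w, w = v - v' by exists (v - v').
have tw : dot t w = 0 by rewrite dotC wE dotBl !(dotC _ t) tv tv' subrr.
pose k := dot w w / 4.
have den (s : R) : 1 + k * s ^+ 2 != 0.
  by rewrite gt_eqF // ltr_wpDr // mulr_ge0 ?sqr_ge0 // divr_ge0 // dot_ge0.
pose c s : 'rV[R]_3 := (1 + k * s ^+ 2)^-1 *: ((1 - k * s ^+ 2) *: t + s *: w).
have cS s : sphere2 (c s).
  have tt : dot t t = 1 by exact: tS.
  have ww : dot w w = 4 * k by rewrite /k; field.
  rewrite /sphere2 /= /c dotZl dotZr !(dotDl, dotDr, dotZl, dotZr) (dotC w t).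
  by rewrite tw tt ww; field; exact: den.
have c0 : c 0 = t.
  by rewrite /c expr0n mulr0 addr0 subr0 invr1 !scale1r scale0r addr0.
have dci i j : is_derive (0 : R) (1 : R) (fun s => c s i j) (w i j).
  have -> : (fun s : R => c s i j) =
      (fun s : R => ((1 - k * s ^+ 2) * t i j + s * w i j) / (1 + k * s ^+ 2)).
    by apply/funext => s; rewrite !mxE mulrC.
  have dn : is_derive (0 : R) (1 : R)
      (fun s : R => (1 - k * s ^+ 2) * t i j + s * w i j) (w i j).
    by apply: is_derive_eq; rewrite /GRing.scale /=; ring.
  have dd : is_derive (0 : R) (1 : R) (fun s : R => 1 + k * s ^+ 2) 0.
    by apply: is_derive_eq; rewrite /GRing.scale /=; ring.
  apply: (is_derive_eq (@is_derive_div _ _ _ 0 _ _ (den 0) dn dd)).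
  by rewrite expr0n mulr0 addr0 mulr1 mulr0 subr0 expr1n divr1.
have [dc Dc] : is_derive (0 : R) (1 : R) c w by exact: is_derive_mx.
have [_ E] := dv c cS c0 dc; have [_] := dv' c cS c0 dc.
rewrite E Dc => /eqP; rewrite -subr_eq0 -dotBl -wE => /eqP /dot_eq0 /eqP.
by rewrite wE subr_eq0 => /eqP.
Qed.

Lemma sphere_gradientE (rho : 'rV[R]_3 -> R) t v : sphere2 t ->
  is_sphere_gradient rho t v -> sphere_gradient rho t = v.
Proof.
move=> tS tv; apply: (sphere_gradient_unique tS _ tv).
exact: (@getPex _ [set v | is_sphere_gradient rho t v] (ex_intro _ v tv)).
Qed.

End Gradient.

(** * The surface in stereographic coordinates *)

Section Surface.
Variables (R : realType) (p e1 e2 : 'rV[R]_3).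
Hypotheses (pS : sphere2 p) (pe : tangent_frame p e1 e2).
Implicit Types (z v : 'rV[R]_2) (W g h : R).

(** The point R_rho t for t of coordinates [z], when [W] is exp (rho t) and [g], [h]
    are the partial derivatives of rho in these coordinates at [z]. *)
Definition surface_point z W g h : 'rV[R]_3 :=
  let x := z 0 0 in let y := z 0 1 in let s := dot z z in
  let M := ((4 + s) / 4) ^+ 2 * (g ^+ 2 + h ^+ 2) in
  let q := M + (W + 1) ^+ 2 in
  let a := (M + (W ^+ 2 - 1)) / q in
  frame_comb p e1 e2
    (a * ((4 - s) / (4 + s)) - 2 * ((x * g + y * h) / q))
    (a * (4 * x / (4 + s))
       + 2 * (((1 + (y ^+ 2 - x ^+ 2) / 4) * g - x * y / 2 * h) / q))
    (a * (4 * y / (4 + s))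
       + 2 * (((1 + (x ^+ 2 - y ^+ 2) / 4) * h - x * y / 2 * g) / q)).

(** The derivative of [surface_point] at the origin in the direction [v], when
    [g] and [h] vary at the rates [dg] and [dh]; as [W] is an exponential, its rate
    is [W * df]. Here [dM], [dq], [da] are the rates of [M], [q], [a]. *)
Definition surface_velocity W g h v (dg dh : R) : 'rV[R]_3 :=
  let M := g ^+ 2 + h ^+ 2 in
  let q := M + (W + 1) ^+ 2 in
  let a := (M + (W ^+ 2 - 1)) / q in
  let df := v 0 0 * g + v 0 1 * h in
  let dM := 2 * (g * dg + h * dh) in
  let dq := dM + 2 * (W + 1) * W * df in
  let da := (dM + 2 * W ^+ 2 * df) / q - a * dq / q in
  frame_comb p e1 e2
    (da - 2 * df / q)
    (a * v 0 0 + 2 * (dg / q - g * dq / q ^+ 2))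
    (a * v 0 1 + 2 * (dh / q - h * dq / q ^+ 2)).

Lemma surface_point0 W g h (q := g ^+ 2 + h ^+ 2 + (W + 1) ^+ 2) :
  surface_point 0 W g h = frame_comb p e1 e2
    ((g ^+ 2 + h ^+ 2 + (W ^+ 2 - 1)) / q) (2 * (g / q)) (2 * (h / q)).
Proof.
have dot00 : dot (0 : 'rV[R]_2) 0 = 0 by rewrite dot_row2 !mxE expr0n addr0.
rewrite /surface_point dot00 !mxE addr0 subr0 divff ?pnatr_eq0 // expr1n mul1r -/q.
by congr frame_comb; ring.
Qed.

Lemma horospherical_surface_stereo (rho : 'rV[R]_3 -> R) z g h :
  is_diff z (rho \o stereo_inv p e1 e2) (fun w => w 0 0 * g + w 0 1 * h) ->
  horospherical_surface rho (stereo_inv p e1 e2 z) =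
  surface_point z (expR (rho (stereo_inv p e1 e2 z))) g h.
Proof.
move=> df; have tS : sphere2 (stereo_inv p e1 e2 z) by exact: stereo_inv_sphere2.
rewrite /horospherical_surface.
rewrite (sphere_gradientE tS (is_sphere_gradient_stereo pS pe df)).
set W := expR (rho _); rewrite dot_stereo_gradient // expRM_natl -/W.
rewrite /stereo_gradient {1}stereo_invE scalerA frame_combDZ /surface_point.
by congr frame_comb; ring.
Qed.

Lemma is_diff_surface_point (f g h dg dh : 'rV[R]_2 -> R) :
  is_diff 0 f (fun v => v 0 0 * g 0 + v 0 1 * h 0) ->
  is_diff 0 g dg -> is_diff 0 h dh ->
  is_diff 0 (fun z => surface_point z (expR (f z)) (g z) (h z))
    (fun v => surface_velocity (expR (f 0)) (g 0) (h 0) v (dg v) (dh v)).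
Proof.
move=> f0 g0 h0; rewrite /surface_velocity.
pose df (v : 'rV[R]_2) := v 0 0 * g 0 + v 0 1 * h 0.
pose s (z : 'rV[R]_2) := dot z z; pose W z := expR (f z).
pose M z := ((4 + s z) / 4) ^+ 2 * (g z ^+ 2 + h z ^+ 2).
pose q z := M z + (W z + 1) ^+ 2.
pose a z := (M z + (W z ^+ 2 - 1)) / q z.
pose dM v := 2 * (g 0 * dg v + h 0 * dh v).
pose dq v := dM v + 2 * (W 0 + 1) * W 0 * df v.
pose X (w : 'rV[R]_2) : R := w 0 0; pose Y (w : 'rV[R]_2) : R := w 0 1.
have dX : is_diff 0 X X by exact: is_diff_coord.
have dY : is_diff 0 Y Y by exact: is_diff_coord.
have X0 : X 0 = 0 by rewrite /X mxE.
have Y0 : Y 0 = 0 by rewrite /Y mxE.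
have s0 : s 0 = 0 by rewrite /s dot_row2 !mxE expr0n addr0.
have ME : M 0 = g 0 ^+ 2 + h 0 ^+ 2.
  by rewrite /M s0 addr0 divff ?pnatr_eq0 // expr1n mul1r.
rewrite -ME -/(W 0) -/(q 0) -/(a 0).
have ds : is_diff 0 s (fun=> 0).
  have -> : s = fun z => X z * X z + Y z * Y z.
    by apply/funext => z; rewrite /s dot_row2 !expr2.
  apply: (is_diff_eq (is_diff_addf (is_diff_mulf dX dX) (is_diff_mulf dY dY))).
  by apply/funext => v; rewrite X0 Y0 !mul0r !addr0.
have d4s : is_diff 0 (fun z => 4 + s z) (fun=> 0).
  apply: (is_diff_eq (is_diff_addf (is_diff_cstf _ 4) ds)).
  by apply/funext => v; rewrite addr0.
have s40 : 4 + s 0 != 0 by rewrite s0 addr0 pnatr_eq0.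
(* The inverse stereographic projection is p + x e1 + y e2 to first order. *)
have dlat : is_diff 0 (fun z => (4 - s z) / (4 + s z)) (fun=> 0).
  apply: (is_diff_eq (is_diff_divf (is_diff_subf (is_diff_cstf _ 4) ds) d4s s40)).
  by apply/funext => v; rewrite subr0 mulr0 !mul0r subr0.
have dlon (Z : 'rV[R]_2 -> R) : is_diff 0 Z Z -> is_diff 0 (fun z => 4 * Z z / (4 + s z)) Z.
  move=> dZ; apply: (is_diff_eq (is_diff_divf (is_diff_scalf 4 dZ) d4s s40)).
  by apply/funext => v; rewrite mulr0 mul0r subr0 s0; field.
have dW : is_diff 0 W (fun v => df v * W 0).
  exact: (is_diff_comp f0 (is_diff_expR (f 0))).
have ddivc (c : R) (u du : 'rV[R]_2 -> R) : c != 0 -> is_diff (0 : 'rV[R]_2) u du ->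
    is_diff 0 (fun z => u z / c) (fun w => du w / c).
  move=> c0 u'; apply: (is_diff_eq (is_diff_divf u' (is_diff_cstf _ c) c0)).
  by apply/funext => w; rewrite mulr0 mul0r subr0.
have n4 : (4 : R) != 0 by rewrite pnatr_eq0.
have n2 : (2 : R) != 0 by rewrite pnatr_eq0.
have dM' : is_diff 0 M dM.
  apply: (is_diff_eq (is_diff_mulf (is_diff_sqrf (ddivc _ _ _ n4 d4s))
    (is_diff_addf (is_diff_sqrf g0) (is_diff_sqrf h0)))).
  by apply/funext => v; rewrite s0 /dM; field.
have dq' : is_diff 0 q dq.
  apply: (is_diff_eq (is_diff_addf dM' (is_diff_sqrf (is_diff_addf dW (is_diff_cstf _ 1))))).
  by apply/funext => v; rewrite /dq; ring.
have W_gt0 : 0 < W 0 by exact: expR_gt0.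
have qn0 : q 0 != 0.
  have W1 : 0 < (W 0 + 1) ^+ 2 by rewrite exprn_gt0 // addr_gt0.
  have M_ge0 : 0 <= M 0 by rewrite mulr_ge0 ?sqr_ge0 // addr_ge0 ?sqr_ge0.
  by rewrite gt_eqF // ltr_wpDl.
have da' : is_diff 0 a
    (fun v => (dM v + 2 * W 0 ^+ 2 * df v) / q 0 - a 0 * dq v / q 0).
  apply: (is_diff_eq (is_diff_divf (is_diff_addf dM'
    (is_diff_subf (is_diff_sqrf dW) (is_diff_cstf _ 1))) dq' qn0)).
  by apply/funext => v; rewrite /a; field.
have dquot (u du : 'rV[R]_2 -> R) (n : R := 2) : is_diff (0 : 'rV[R]_2) u du ->
    is_diff 0 (fun z => n * (u z / q z)) (fun w => n * (du w / q 0 - u 0 * dq w / q 0 ^+ 2)).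
  by move=> u'; exact: (is_diff_scalf n (is_diff_divf u' dq' qn0)).
(* Both tangential coefficients of the gradient have this form, which is [u] to
   first order at the origin. *)
have dtan (Z Z' u u' du du' : 'rV[R]_2 -> R) : Z 0 = 0 -> Z' 0 = 0 ->
    is_diff 0 Z Z -> is_diff 0 Z' Z' -> is_diff 0 u du -> is_diff 0 u' du' ->
    is_diff 0 (fun z => (1 + (Z' z ^+ 2 - Z z ^+ 2) / 4) * u z - Z z * Z' z / 2 * u' z) du.
  move=> Z0 Z'0 dZ dZ' hu hu'.
  have d1 := is_diff_addf (is_diff_cstf _ 1)
    (ddivc _ _ _ n4 (is_diff_subf (is_diff_sqrf dZ') (is_diff_sqrf dZ))).
  apply: (is_diff_eq (is_diff_subf (is_diff_mulf d1 hu)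
    (is_diff_mulf (ddivc _ _ _ n2 (is_diff_mulf dZ dZ')) hu'))).
  by apply/funext => w; rewrite Z0 Z'0; field.
apply: is_diff_frame_comb; rewrite -/s -/W -/M -/q -/a.
- apply: (is_diff_eq (is_diff_subf (is_diff_mulf da' dlat)
    (dquot _ _ (is_diff_addf (is_diff_mulf dX g0) (is_diff_mulf dY h0))))).
  by apply/funext => v; rewrite X0 Y0 s0 /X /Y /dq /dM /df; field.
- apply: (is_diff_eq (is_diff_addf (is_diff_mulf da' (dlon _ dX))
    (dquot _ _ (dtan _ _ _ _ _ _ X0 Y0 dX dY g0 h0)))).
  by apply/funext => v; rewrite s0 X0 Y0 /X /dq /dM /df; field.
- have dtY := dtan _ _ _ _ _ _ Y0 X0 dY dX h0 g0.
  have -> : (fun z : 'rV[R]_2 => a z * (4 * z 0 1 / (4 + s z)) + 2 * (((1 +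
      (z 0 0 ^+ 2 - z 0 1 ^+ 2) / 4) * h z - z 0 0 * z 0 1 / 2 * g z) / q z)) =
    (fun z : 'rV[R]_2 => a z * (4 * Y z / (4 + s z)) + 2 * (((1 +
      (X z ^+ 2 - Y z ^+ 2) / 4) * h z - Y z * X z / 2 * g z) / q z)).
    by apply/funext => z; rewrite (mulrC (Y z)).
  apply: (is_diff_eq (is_diff_addf (is_diff_mulf da' (dlon _ dY)) (dquot _ _ dtY))).
  by apply/funext => v; rewrite s0 X0 Y0 /Y /dq /dM /df; field.
Qed.

End Surface.

(** * The induced metric *)

Section SurfaceMetric.
Variables (R : realType) (p e1 e2 : 'rV[R]_3).
Hypotheses (pS : sphere2 p) (pe : tangent_frame p e1 e2).
Variables (W g h rxx rxy ryy : R).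
Hypothesis W_gt0 : 0 < W.

Let q := g ^+ 2 + h ^+ 2 + (W + 1) ^+ 2.
Let a11 := W / 2 + (rxx + (h ^+ 2 - g ^+ 2 - 1) / 2) / W.
Let a12 := (rxy - g * h) / W.
Let a22 := W / 2 + (ryy + (g ^+ 2 - h ^+ 2 - 1) / 2) / W.
Let k (v : 'rV[R]_2) := v 0 0 * a11 + v 0 1 * a12.
Let l (v : 'rV[R]_2) := v 0 0 * a12 + v 0 1 * a22.

Let W_neq0 : W != 0. Proof. by rewrite gt_eqF. Qed.

Let q_neq0 : q != 0.
Proof.
have W1 : 0 < (W + 1) ^+ 2 by rewrite exprn_gt0 // addr_gt0.
by rewrite gt_eqF // ltr_wpDl // addr_ge0 ?sqr_ge0.
Qed.

Lemma one_minus_norm_surface_point :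
  1 - dot (surface_point p e1 e2 0 W g h) (surface_point p e1 e2 0 W g h) =
  4 * W / q.
Proof.
rewrite surface_point0 dot_frame_comb // -/q; move: q_neq0; rewrite /q => q0.
by field.
Qed.

(** The surface point is t - 2 n / |n|^2 with n = (W + 1) t - D, and the
    derivative of n |-> n / |n|^2 is the reflection along n divided by |n|^2. *)
Lemma surface_velocity_reflection (v : 'rV[R]_2) :
  surface_velocity p e1 e2 W g h v (v 0 0 * rxx + v 0 1 * rxy)
    (v 0 0 * rxy + v 0 1 * ryy) =
  (2 * W / q) *: reflect_along (frame_comb p e1 e2 (W + 1) (- g) (- h))
    (frame_comb p e1 e2 0 (k v) (l v)).
Proof.
rewrite reflect_along_frame_comb //.
have -> : (W + 1) ^+ 2 + (g ^+ 2 + h ^+ 2) = q by rewrite addrC.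
rewrite frame_combZ /surface_velocity -/q /k /l /a11 /a12 /a22.
move: q_neq0 W_neq0; rewrite /q => q0 W0.
by congr frame_comb; field; rewrite W0 q0.
Qed.

Lemma pullback_surface (F : 'rV[R]_2 -> 'rV[R]_3) :
  F 0 = surface_point p e1 e2 0 W g h ->
  is_diff 0 F (fun v => surface_velocity p e1 e2 W g h v
    (v 0 0 * rxx + v 0 1 * rxy) (v 0 0 * rxy + v 0 1 * ryy)) ->
  pullback_metric (@hyperbolic_metric R) F 0 = mx22 a11 a12 a12 a22 ^+ 2.
Proof.
move=> F0 dF.
have metricE u v :
    hyperbolic_metric (F 0) ('d F 0 u) ('d F 0 v) = k u * k v + l u * l v.
  rewrite /hyperbolic_metric F0 one_minus_norm_surface_point diff_val.
  rewrite !surface_velocity_reflection dotZl dotZr dot_reflect_along; last first.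
    by rewrite dot_frame_comb // !mulrNN -!expr2 -addrA addrC; exact: q_neq0.
  rewrite dot_frame_comb // mul0r add0r; move: q_neq0 W_neq0 => q0 W0.
  by field; rewrite W0 q0.
have e_0 (i : 'I_2) : ('e_i : 'rV[R]_2) 0 0 = (i == 0)%:R.
  by rewrite mxE eqxx eq_sym.
have e_1 (i : 'I_2) : ('e_i : 'rV[R]_2) 0 1 = (i == 1)%:R.
  by rewrite mxE eqxx eq_sym.
apply/matrixP => i j.
rewrite mxE metricE expr2 mxE !big_ord_recl big_ord0 addr0 !mxE /=.
rewrite /k /l !e_0 !e_1.
by case: i => -[|[|//]] lti; case: j => -[|[|//]] ltj /=; ring.
Qed.

End SurfaceMetric.

Theorem proposition5p1 (R : realType) (Omega : set 'rV[R]_3)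
    (rho : 'rV[R]_3 -> R) (p e1 e2 : 'rV[R]_3)
    (dom_Omega : sphere_domain Omega) (C2_rho : sphere_C2 Omega rho)
    (Omega_p : Omega p) (frame_p : tangent_frame p e1 e2) :
  let f := rho \o stereo_inv p e1 e2 in
  let dx := fun g : 'rV[R]_2 -> R => 'D_('e_0) g in
  let dy := fun g : 'rV[R]_2 -> R => 'D_('e_1) g in
  let r := f 0 in
  let rx := dx f 0 in
  let ry := dy f 0 in
  let rxx := dx (dx f) 0 in
  let rxy := dy (dx f) 0 in
  let ryy := dy (dy f) 0 in
  pullback_metric (@hyperbolic_metric R)
    (horospherical_surface rho \o stereo_inv p e1 e2) 0
  = mx22
      (expR r / 2 + (rxx + (ry ^+ 2 - rx ^+ 2 - 1) / 2) * expR (- r))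
      ((rxy - rx * ry) * expR (- r))
      ((rxy - rx * ry) * expR (- r))
      (expR r / 2 + (ryy + (rx ^+ 2 - ry ^+ 2 - 1) / 2) * expR (- r)) ^+ 2.
Proof.
move=> f dx dy r rx ry rxx rxy ryy; rewrite expRN.
have [[U oU OmegaE] _] := dom_Omega.
have pS : sphere2 p by move: Omega_p; rewrite OmegaE => -[].
pose E := stereo_inv p e1 e2.
have E0 : E 0 = p.
  rewrite /E stereo_invE dot_row2 !mxE expr0n /= !addr0 subr0 divff ?pnatr_eq0 //.
  by rewrite mulr0 mul0r /frame_comb scale1r !scale0r !addr0.
pose D := E @^-1` Omega.
have oD : open D.
  have -> : D = E @^-1` U.
    apply/seteqP; split=> z; rewrite /D /= OmegaE; first by case.
    by move=> Uz; split => //; exact: stereo_inv_sphere2.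
  by apply: open_comp oU => z _; exact: continuous_stereo_inv.
have D0 : D 0 by rewrite /D /= E0.
have C2f : class_C 2 D f := C2_rho _ _ _ pS frame_p.
have C1f : class_C 1 D f := class_C_le C2f.
have C1x : class_C 1 D (dx f) by have [_ /(_ 0)[]] := C2f.
have C1y : class_C 1 D (dy f) by have [_ /(_ 1)[]] := C2f.
have rxyE : dx (dy f) 0 = rxy := esym (class_C2_mixed_derivatives oD D0 C2f).
have df0 : is_diff 0 f (fun v => v 0 0 * rx + v 0 1 * ry) :=
  class_C1_is_diff oD D0 C1f.
have dfx : is_diff 0 (dx f) (fun v => v 0 0 * rxx + v 0 1 * rxy) :=
  class_C1_is_diff oD D0 C1x.
have dfy : is_diff 0 (dy f) (fun v => v 0 0 * rxy + v 0 1 * ryy).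
  by rewrite -rxyE; exact: (class_C1_is_diff oD D0 C1y).
have dsurf := is_diff_surface_point p e1 e2 df0 dfx dfy.
apply: (pullback_surface pS frame_p (expR_gt0 r)).
  by rewrite /= (horospherical_surface_stereo pS frame_p df0).
apply: (near_eq_is_diff _ dsurf).
apply: filterS (open_nbhs_nbhs (conj oD D0)) => z Dz.
by rewrite /= (horospherical_surface_stereo pS frame_p (class_C1_is_diff oD Dz C1f)).
Qed.
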